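(* Let $\lambda\in\mathbb{R}$ and let $a,a^{+}$ be boson operators, i.e. linear operators on a complex vector space with $aa^{+}-a^{+}a=1$. For all integers $m,r\ge 0$, $$(a^{+}a)_{m,\lambda}(a^{+})^{r}=\sum_{l=0}^{m}{m+r \brace l+r}_{r,\lambda}(a^{+})^{l+r}a^{l}.$$ In addition, for all integers $m,r$ with $m\ge r\ge 0$, $$(a^{+}a)_{m-r,\lambda}(a^{+})^{r}a^{r}=\sum_{l=r}^{m}{m\brace l}_{r,\lambda}(a^{+})^{l}a^{l}.$$
   Context: The boson annihilation and creation operators $a$, $a^{+}$ satisfy $[a,a^{+}]=aa^{+}-a^{+}a=1$ (the identity operator); they can be realized for instance by $a=\frac{d}{dx}$ and $a^{+}=x$ (multiplication by $x$). For $\lambda\in\mathbb{R}$ and $y$ a number, indeterminate or operator, $(y)_{0,\lambda}=1$ and $(y)_{n,\lambda}=y(y-\lambda)(y-2\lambda)\cdots(y-(n-1)\lambda)$ for $n\ge 1$ (for operators, scalars stand for scalar multiples of the identity). Also $(y)_{0}=1$ and $(y)_{n}=y(y-1)\cdots(y-n+1)$ for $n\ge1$. For an integer $r\ge 0$, the degenerate $r$-Stirling numbers of the second kind ${n+r \brace k+r}_{r,\lambda}$ ($0\le k\le n$) are defined by the polynomial identity $$(y+r)_{n,\lambda}=\sum_{k=0}^{n}{n+r \brace k+r}_{r,\lambda}(y)_{k}\quad (n\ge 0).$$ In particular, for $m\ge l\ge r$, ${m\brace l}_{r,\lambda}$ means ${(m-r)+r\brace (l-r)+r}_{r,\lambda}$.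 *)

(* Defs.v *)
From HB Require Import structures.
From mathcomp Require Export all_boot all_order all_algebra.
From mathcomp Require Import boolp.
From mathcomp Require Export reals complex.

Set Implicit Arguments.
Unset Strict Implicit.
Unset Printing Implicit Defensive.

Import GRing.Theory.
Local Open Scope ring_scope.

(* The ring (with product the composition) and module of all linear operators
   on a module. MathComp's 'End(V) is restricted to finite dimension, where
   boson operators exist only on the zero space, and algType excludes the zero
   ring, which is the operator ring of the zero space: hence a pzRingType that
   is also an lmodType. *)
Definition linop (K : comPzRingType) (V : lmodType K) : Type := {linear V -> V}.

Section LinearOperators.
Variables (K : comPzRingType) (V : lmodType K).
Implicit Types (f g h : linop V) (k : K) (v : V).

Definition linop_fun f : V -> V := (f : {linear V -> V}).

Lemma linopP f g : linop_fun f =1 linop_fun g -> f = g.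
Proof.
move=> fg; have := funext fg; case: f g {fg} => [f cf] [g cg] /= fg.
rewrite /linop_fun /= in fg; case: g / fg cg => cg.
case: cf cg => [[cf1] [cf2]] [[cg1] [cg2]].
by rewrite (Prop_irrelevance cf1 cg1) (Prop_irrelevance cf2 cg2).
Qed.

Definition scale_linop_fun k f v := k *: linop_fun f v.

Lemma scale_linop_is_linear k f : linear (scale_linop_fun k f).
Proof.
by move=> c u v; rewrite /scale_linop_fun /linop_fun linearP scalerDr !scalerA mulrC.
Qed.
HB.instance Definition _ k f :=
  GRing.isLinear.Build K V V *:%R (scale_linop_fun k f)
    (scale_linop_is_linear k f).

Definition linop_zero : linop V := \0 : {linear V -> V}.
Definition linop_opp f : linop V := (\- (f : {linear V -> V})) : {linear V -> V}.
Definition linop_add f g : linop V :=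
  ((f : {linear V -> V}) \+ (g : {linear V -> V})) : {linear V -> V}.
Definition linop_one : linop V := idfun : {linear V -> V}.
Definition linop_mul f g : linop V :=
  ((f : {linear V -> V}) \o (g : {linear V -> V})) : {linear V -> V}.
Definition linop_scale k f : linop V :=
  scale_linop_fun k f : {linear V -> V}.

Lemma linop_addA : associative linop_add.
Proof. by move=> f g h; apply: linopP => v; apply: addrA. Qed.
Lemma linop_addC : commutative linop_add.
Proof. by move=> f g; apply: linopP => v; apply: addrC. Qed.
Lemma linop_add0 : left_id linop_zero linop_add.
Proof. by move=> f; apply: linopP => v; apply: add0r. Qed.
Lemma linop_addN : left_inverse linop_zero linop_opp linop_add.
Proof. by move=> f; apply: linopP => v; apply: addNr. Qed.
Lemma linop_mulA : associative linop_mul.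
Proof. by move=> f g h; apply: linopP. Qed.
Lemma linop_mul1l : left_id linop_one linop_mul.
Proof. by move=> f; apply: linopP. Qed.
Lemma linop_mul1r : right_id linop_one linop_mul.
Proof. by move=> f; apply: linopP. Qed.
Lemma linop_mulDl : left_distributive linop_mul linop_add.
Proof. by move=> f g h; apply: linopP. Qed.
Lemma linop_mulDr : right_distributive linop_mul linop_add.
Proof. by move=> f g h; apply: linopP => v; apply: raddfD. Qed.

HB.instance Definition _ := gen_eqMixin (linop V).
HB.instance Definition _ := gen_choiceMixin (linop V).
HB.instance Definition _ := GRing.isZmodule.Build (linop V)
  linop_addA linop_addC linop_add0 linop_addN.
HB.instance Definition _ := GRing.Zmodule_isPzRing.Build (linop V)
  linop_mulA linop_mul1l linop_mul1r linop_mulDl linop_mulDr.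

Lemma linop_scaleA k k' f :
  linop_scale k (linop_scale k' f) = linop_scale (k * k') f.
Proof. by apply: linopP => v; apply: scalerA. Qed.
Lemma linop_scale1 : left_id 1 linop_scale.
Proof. by move=> f; apply: linopP => v; apply: scale1r. Qed.
Lemma linop_scaleDr : right_distributive linop_scale +%R.
Proof. by move=> k f g; apply: linopP => v; apply: scalerDr. Qed.
Lemma linop_scaleDl f : {morph linop_scale^~ f : k k' / k + k'}.
Proof. by move=> k k'; apply: linopP => v; apply: scalerDl. Qed.

HB.instance Definition _ := GRing.Zmodule_isLmodule.Build K (linop V)
  linop_scaleA linop_scale1 linop_scaleDr linop_scaleDl.

Lemma linop0E v : linop_fun 0 v = 0. Proof. by []. Qed.
Lemma linopNE f v : linop_fun (- f) v = - linop_fun f v. Proof. by []. Qed.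
Lemma linopDE f g v : linop_fun (f + g) v = linop_fun f v + linop_fun g v.
Proof. by []. Qed.
Lemma linop1E v : linop_fun 1 v = v. Proof. by []. Qed.
Lemma linopME f g v : linop_fun (f * g) v = linop_fun f (linop_fun g v).
Proof. by []. Qed.
Lemma linopZE k f v : linop_fun (k *: f) v = k *: linop_fun f v.
Proof. by []. Qed.

Definition scalar_op k : linop V := k *: (1 : linop V).

Lemma linop_scaleAl k f g : k *: (f * g) = (k *: f) * g.
Proof. by apply: linopP. Qed.
Lemma linop_scaleAr k f g : k *: (f * g) = f * (k *: g).
Proof. by apply: linopP => v; rewrite linopME !linopZE /linop_fun linearZ. Qed.

End LinearOperators.

(* (y)_{n,lam} = y (y - lam) ... (y - (n-1) lam), for y in any ring A; lam is
   passed as the element of A that it stands for (lam%:P, scalar_op lam, ...). *)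
Definition dfalling (A : pzRingType) (y lam : A) (n : nat) : A :=
  \prod_(i < n) (y - lam *+ i).

Definition falling (A : pzRingType) (y : A) (n : nat) : A :=
  \prod_(i < n) (y - i%:R).

Section DegenerateStirling.
Variable R : comNzRingType.
Implicit Types (lam : R) (n m l r k : nat).

Lemma falling_monic k : falling 'X k \is @monic R.
Proof. by apply: monic_prod => i _; rewrite -polyC_natr monicXsubC. Qed.

Lemma size_falling k : size (falling 'X k : {poly R}) = k.+1.
Proof.
rewrite /falling; under eq_bigr do rewrite -polyC_natr.
by rewrite -(big_mkord xpredT (fun i => 'X - i%:R%:P)) size_prod_XsubC size_iota
           subn0.
Qed.

Lemma falling_span n (p : {poly R}) : (size p <= n)%N ->
  exists c : {ffun 'I_n -> R}, p = \sum_(k < n) c k *: falling 'X k.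
Proof.
elim: n p => [|n IHn] p szp.
  exists [ffun=> 0]; rewrite big_ord0.
  by apply/eqP; rewrite -size_poly_eq0 -leqn0.
have szq : (size (p - p`_n *: falling 'X n)%R <= n)%N.
  apply/leq_sizeP => j; rewrite leq_eqVlt coefB coefZ => /predU1P[<-|ltnj].
    have /monicP := falling_monic n.
    by rewrite /lead_coef size_falling => ->; rewrite mulr1 subrr.
  rewrite (nth_default _ (leq_trans szp ltnj)) [X in _ * X]nth_default.
    by rewrite mulr0 subrr.
  by rewrite size_falling.
have [c pE] := IHn _ szq.
exists [ffun i : 'I_n.+1 => if insub (i : nat) is Some j then c j else p`_n].
rewrite big_ord_recr /= ffunE insubF ?ltnn // -[LHS](subrK (p`_n *: falling 'X n)).
congr (_ + _); rewrite pE; apply: eq_bigr => i _.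
by rewrite ffunE /= (insubT (fun j => j < n)%N (ltn_ord i)) /=; congr (c _ *: _); apply: val_inj.
Qed.

Lemma falling_free n (c : 'I_n -> R) :
  \sum_(k < n) c k *: falling 'X k = 0 :> {poly R} -> forall i, c i = 0.
Proof.
elim: n c => [|n IHn] c; first by move=> _ [].
rewrite big_ord_recr /= => c0.
have cn : c ord_max = 0.
  have := congr1 (fun p : {poly R} => p`_n) c0.
  rewrite coefD coefZ coef0 coef_sum big1 => [|i _].
    have /monicP := falling_monic n.
    by rewrite /lead_coef size_falling => ->; rewrite add0r mulr1.
  by rewrite coefZ nth_default ?mulr0 // size_falling.
have := c0; rewrite cn scale0r addr0 => /IHn cl k.
have [j ->|->] := unliftP ord_max k; last exact: cn.
rewrite -(cl j); congr (c _); apply: val_inj => /=.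
by rewrite /bump leqNgt ltn_ord.
Qed.

Lemma size_dfalling lam r n :
  size (dfalling ('X + r%:R) lam%:P n) = n.+1.
Proof.
rewrite /dfalling.
under eq_bigr => i _ do
  rewrite -(polyCMn i lam) -polyC_natr -addrA -polyCB -opprB polyCN.
by rewrite -(big_mkord xpredT (fun i => 'X - (lam *+ i - r%:R)%:P))
           size_prod_XsubC size_iota subn0.
Qed.

Lemma ex_dstirling2 lam r n : exists c : {ffun 'I_n.+1 -> R},
  dfalling ('X + r%:R) lam%:P n == \sum_(k < n.+1) c k *: falling 'X k.
Proof.
have [|c ->] := @falling_span n.+1 (dfalling ('X + r%:R) lam%:P n).
  by rewrite size_dfalling.
by exists c.
Qed.

(* dstirling2 r lam m l is {m brace l}_{r,lam}: the upper and lower arguments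
   are shifted by r, so this is the coefficient of (y)_(l-r) in
   (y + r)_{m-r,lam}; it is extended by 0 unless r <= l <= m. The coefficients
   are picked by xchoose, dstirling2P being their defining identity and
   dstirling2_uniq their uniqueness. *)
Definition dstirling2 r lam m l : R :=
  if (r <= l <= m)%N then xchoose (ex_dstirling2 lam r (m - r)) (inord (l - r))
  else 0.

Theorem dstirling2P r lam n :
  dfalling ('X + r%:R) lam%:P n =
    \sum_(k < n.+1) dstirling2 r lam (n + r) (k + r) *: falling 'X k.
Proof.
rewrite (eqP (xchooseP (ex_dstirling2 lam r n))).
apply: eq_bigr => k _; congr (_ *: _).
by rewrite /dstirling2 leq_addl leq_add2r -ltnS ltn_ord !addnK inord_val.
Qed.

Theorem dstirling2_uniq r lam n (c : 'I_n.+1 -> R) :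
  dfalling ('X + r%:R) lam%:P n = \sum_(k < n.+1) c k *: falling 'X k ->
  forall i, c i = dstirling2 r lam (n + r) (i + r).
Proof.
rewrite dstirling2P => /esym/eqP; rewrite -subr_eq0 -sumrB => /eqP.
under eq_bigr do rewrite -scalerBl.
by move=> /falling_free ck0 k; apply/eqP; rewrite -subr_eq0 ck0.
Qed.

End DegenerateStirling.

(* Main.v *)
Require Import Defs.

Import GRing.Theory.
Local Open Scope ring_scope.
Local Open Scope complex_scope.

(* Write N = a^+ a. Since N a^+ = a^+ (N + 1), moving (a^+)^r to the left turns
   (N)_{m,lam} (a^+)^r into (a^+)^r (N + r)_{m,lam}. Evaluating at N the
   polynomial identity that defines the Stirling numbers then gives the theorem,
   because (N)_l = (a^+)^l a^l. *)

(* horner_morph does not apply: it needs a nonzero target ring, while linop V is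
   the zero ring when V is the zero space. *)
Definition linop_horner {R : nzRingType} {K : comPzRingType} {V : lmodType K}
    (f : {rmorphism R -> K}) (x : linop V) (p : {poly R}) : linop V :=
  \sum_(i < size p) f p`_i *: x ^+ i.

Section LinopHorner.
Set Implicit Arguments.
Unset Strict Implicit.
Variables (R : comNzRingType) (K : comPzRingType) (V : lmodType K).
Variables (f : {rmorphism R -> K}) (x : linop V).
Implicit Types (p q : {poly R}) (c lam : R).
Local Notation ev := (linop_horner f x).

(** Coefficients past the degree vanish, so polynomials of different sizes can be evaluated over one
    common range. *)
Lemma linop_horner_widen n p : (size p <= n)%N ->
  ev p = \sum_(i < n) f p`_i *: x ^+ i.
Proof.
move=> szp; rewrite /linop_horner (big_ord_widen n (fun i => f p`_i *: x ^+ i)) //.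
rewrite big_mkcond; apply: eq_bigr => i _; case: ltnP => // lei.
by rewrite nth_default // rmorph0 scale0r.
Qed.

Lemma linop_hornerD p q : ev (p + q) = ev p + ev q.
Proof.
rewrite !(@linop_horner_widen (maxn (size p) (size q))) ?size_polyD ?leq_maxl
        ?leq_maxr //.
by rewrite -big_split; apply: eq_bigr => i _; rewrite coefD rmorphD scalerDl.
Qed.

Lemma linop_hornerZ c p : ev (c *: p) = f c *: ev p.
Proof.
rewrite (linop_horner_widen (size_scale_leq c p)) scaler_sumr.
by apply: eq_bigr => i _; rewrite coefZ rmorphM scalerA.
Qed.

Lemma linop_hornerMX p : ev (p * 'X) = ev p * x.
Proof.
have szpX : (size (p * 'X)%R <= (size p).+1)%N.
  by rewrite (leq_trans (size_polyMleq _ _)) // size_polyX addn2.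
(* The constant coefficient of [p * 'X] is 0: the first term drops and the others shift by one. *)
rewrite (linop_horner_widen szpX) big_ord_recl coefMX rmorph0 scale0r add0r.
rewrite mulr_suml; apply: eq_bigr => i _.
by rewrite coefMX /= exprSr linop_scaleAl.
Qed.

Lemma linop_horner1 : ev 1 = 1.
Proof.
by rewrite /linop_horner size_poly1 big_ord1 coef1 rmorph1 scale1r.
Qed.

Lemma linop_horner_sum n (F : 'I_n -> {poly R}) :
  ev (\sum_(i < n) F i) = \sum_(i < n) ev (F i).
Proof.
apply: (big_morph _ linop_hornerD).
by rewrite /linop_horner size_poly0 big_ord0.
Qed.

(** The only multiplicativity needed: both kinds of falling product grow by one monic linear factor
    on the right. *)
Lemma linop_hornerMXaddC p c :
  ev (p * ('X + c%:P)) = ev p * (x + scalar_op V (f c)).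
Proof.
rewrite mulrDr linop_hornerD linop_hornerMX mulrC mul_polyC linop_hornerZ.
by rewrite mulrDr -linop_scaleAr mulr1.
Qed.

Lemma linop_horner_falling n : ev (falling 'X n) = falling x n.
Proof.
elim: n => [|n IHn]; first by rewrite /falling !big_ord0 linop_horner1.
rewrite /falling !big_ord_recr /= -!/(falling _ _) -polyC_natr -polyCN.
by rewrite linop_hornerMXaddC IHn rmorphN rmorph_nat /scalar_op scaleNr scaler_nat.
Qed.

Lemma linop_horner_dfalling lam r n :
  ev (dfalling ('X + r%:R) lam%:P n) =
    dfalling (x + r%:R) (scalar_op V (f lam)) n.
Proof.
elim: n => [|n IHn]; first by rewrite /dfalling !big_ord0 linop_horner1.
rewrite /dfalling !big_ord_recr /= -!/(dfalling _ _ _) -polyC_natr -polyCMn.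
(* The factor is regrouped as ['X] plus the single constant [r%:R - lam *+ n]. *)
rewrite -addrA -polyCB linop_hornerMXaddC polyC_natr IHn; congr (_ * _).
by rewrite rmorphB rmorph_nat rmorphMn /scalar_op scalerBl scaler_nat -scalerMnl addrA.
Qed.

Lemma dfalling_linop_dstirling2 lam r n :
  dfalling (x + r%:R) (scalar_op V (f lam)) n =
    \sum_(l < n.+1) f (dstirling2 r lam (n + r) (l + r)) *: falling x l.
Proof.
rewrite -linop_horner_dfalling dstirling2P linop_horner_sum.
by apply: eq_bigr => l _; rewrite linop_hornerZ linop_horner_falling.
Qed.

End LinopHorner.

Section Boson.
Set Implicit Arguments.
Unset Strict Implicit.
Variables (A : pzRingType) (a adag : A).
Hypothesis boson : a * adag - adag * a = 1.

(** Each [adag] that the number operator passes contributes one commutator, hence 1. *)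
Lemma boson_number_adagX r :
  (adag * a) * adag ^+ r = adag ^+ r * (adag * a + r%:R).
Proof.
have aad : a * adag = adag * a + 1 by rewrite -boson addrC subrK.
elim: r => [|r IHr]; first by rewrite expr0 mulr1 mul1r addr0.
rewrite exprSr mulrA IHr -!mulrA; congr (_ * _).
rewrite mulrDl -mulrA aad -natr1 -(commr_nat adag r) -mulrDr.
by rewrite (addrC r%:R) addrA addrAC.
Qed.

Lemma boson_aX_number l :
  a ^+ l * (adag * a) = (adag * a + l%:R) * a ^+ l.
Proof.
have aad : a * adag = adag * a + 1 by rewrite -boson addrC subrK.
elim: l => [|l IHl]; first by rewrite expr0 mulr1 mul1r addr0.
rewrite exprS -mulrA IHl !mulrA; congr (_ * _).
by rewrite mulrDr mulrA aad -natr1 (commr_nat a l) -mulrDl addrAC addrA.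
Qed.

(** Moving [a ^+ l] to the right past the new factor [adag * a - l%:R] raises it by [l], which
    leaves exactly [adag * a]. *)
Lemma falling_boson_number l : falling (adag * a) l = adag ^+ l * a ^+ l.
Proof.
elim: l => [|l IHl]; first by rewrite /falling big_ord0 mulr1.
rewrite /falling big_ord_recr /= -/(falling _ _) IHl -mulrA mulrBr.
rewrite boson_aX_number (commr_nat (a ^+ l) l) mulrDl addrK.
by rewrite exprSr exprS !mulrA.
Qed.

Lemma dfalling_boson_adagX (lam : A) n r : GRing.comm adag lam ->
  dfalling (adag * a) lam n * adag ^+ r =
    adag ^+ r * dfalling (adag * a + r%:R) lam n.
Proof.
move=> clam; elim: n => [|n IHn]; first by rewrite /dfalling !big_ord0 mulr1 mul1r.
(* The last factor passes [adag ^+ r] first; the induction hypothesis handles the others. *)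
rewrite /dfalling !big_ord_recr /= -!/(dfalling _ _ _) mulrA -IHn -!mulrA.
congr (_ * _); rewrite mulrBl mulrBr boson_number_adagX; congr (_ - _).
exact/commr_sym/commrMn/commr_sym/commrX/commr_sym.
Qed.

End Boson.

Theorem corollary2 (R : realType) (lam : R) (V : lmodType R[i])
    (a adag : linop V) (boson : a * adag - adag * a = 1) :
  (forall m r : nat,
     dfalling (adag * a) (scalar_op V lam%:C) m * adag ^+ r =
       \sum_(l < m.+1)
          (dstirling2 r lam (m + r) (l + r))%:C *: (adag ^+ (l + r) * a ^+ l))
  /\
  (forall m r : nat, (r <= m)%N ->
     dfalling (adag * a) (scalar_op V lam%:C) (m - r) * adag ^+ r * a ^+ r =
       \sum_(r <= l < m.+1)
          (dstirling2 r lam m l)%:C *: (adag ^+ l * a ^+ l)).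
Proof.
have normal_order m r :
    dfalling (adag * a) (scalar_op V lam%:C) m * adag ^+ r =
      \sum_(l < m.+1)
         (dstirling2 r lam (m + r) (l + r))%:C *: (adag ^+ (l + r) * a ^+ l).
  have comm_lam : GRing.comm adag (scalar_op V lam%:C).
    (* Scalar operators are central. *)
    by rewrite /GRing.comm /scalar_op -linop_scaleAr -linop_scaleAl mulr1 mul1r.
  rewrite dfalling_boson_adagX // dfalling_linop_dstirling2 mulr_sumr.
  apply: eq_bigr => l _.
  by rewrite -linop_scaleAr falling_boson_number // mulrA -exprD (addnC r).
(* The second identity is the first at [m - r], multiplied on the right by [a ^+ r]. *)
split=> // m r lerm; rewrite normal_order subnK // mulr_suml.
(* Reindexing by [l + r] makes the range start at 0; [r <= m] gives it length [(m - r).+1]. *)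
rewrite -[X in \sum_(X <= _ < _) _]add0n big_addn subSn // big_mkord; apply: eq_bigr => l _.
by rewrite -linop_scaleAl -mulrA -exprD.
Qed.
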